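(* Let $((\mathbf{u},p),(\boldsymbol{\phi},r),\mathbf{y})\in V\times V\times Q_{ad}$ solve the continuous optimality system and let $((\mathbf{u}_h,p_h),(\boldsymbol{\phi}_h,r_h),\mathbf{y}_h)\in V_h\times V_h\times Q_{ad}^h$ solve the discrete optimality system (both written out in the context). Let $R\mathbf u,\bar R\boldsymbol\phi\in X$ be the reconstructions defined in the context. Then there is a constant $C>0$, independent of the mesh-size, such that $$\|\mathbf u-\mathbf u_h\|_h\le C\big(\|R\mathbf u-\mathbf u_h\|_h+\|E_h\boldsymbol\phi_h-\Pi_h(E_h\boldsymbol\phi_h)\|_Q+\|\boldsymbol\phi_h-\bar R\boldsymbol\phi\|_h\big)$$ and $$\|\boldsymbol\phi-\boldsymbol\phi_h\|_h\le C\big(\|\boldsymbol\phi_h-\bar R\boldsymbol\phi\|_h+\|R\mathbf u-\mathbf u_h\|_h+\|E_h\boldsymbol\phi_h-\Pi_h(E_h\boldsymbol\phi_h)\|_Q\big).$$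
   Context: All vector spaces are real. Continuous setting. $X,M,W,Q$ are Hilbert spaces, $V=X\times M$, with $X\subset W\subset X'$ with continuous inclusions ($X'$ the dual of $X$). $E:X\to Q$ is continuous and linear; $Q_{ad}\subset Q$ is nonempty, closed and convex. $\mathbf f,\mathbf u_d\in W$ and $\lambda>0$ are given. $a:X\times X\to\mathbb R$, $b:X\times M\to\mathbb R$ are continuous bilinear forms with $|a(\mathbf v,\mathbf z)|\le C_1\|\mathbf v\|_X\|\mathbf z\|_X$ and $|b(\mathbf z,p)|\le C_2\|\mathbf z\|_X\|p\|_M$; with $Z=\{\mathbf v\in X: b(\mathbf v,w)=0\ \forall w\in M\}$, $a$ is $Z$-elliptic: $\alpha\|\mathbf v\|_X^2\le a(\mathbf v,\mathbf v)$ for all $\mathbf v\in Z$, $\alpha>0$; and $b$ satisfies the inf-sup condition $\inf_{p\in M}\sup_{\mathbf z\in X} b(\mathbf z,p)/(\|\mathbf z\|_X\|p\|_M)\ge\beta>0$. Continuous optimality system for $((\mathbf u,p),(\boldsymbol\phi,r),\mathbf y)\in V\times V\times Q_{ad}$: for all $\mathbf z\in X$, $w\in M$, $\mathbf x\in Q_{ad}$, $a(\mathbf u,\mathbf z)+b(\mathbf z,p)=\langle\mathbf y,E\mathbf z\rangle_Q+\langle\mathbf f,\mathbf z\rangle_W$, $b(\mathbf u,w)=0$, $a(\mathbf z,\boldsymbol\phi)-b(\mathbf z,r)=\langle\mathbf u-\mathbf u_d,\mathbf z\rangle_W$, $b(\boldsymbol\phi,w)=0$, $\langle E\boldsymbol\phi+\lambda\mathbf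 y,\mathbf x-\mathbf y\rangle_Q\ge0$. Discrete setting. $X_h\subset W$ is a finite dimensional subspace, $\|\cdot\|_h$ is a norm on $X+X_h$ with $\|\mathbf v\|_h=\|\mathbf v\|_X$ for $\mathbf v\in X$; $M_h\subset M$ is a finite dimensional subspace with norm $\|\cdot\|_M$; $V_h=X_h\times M_h$; $Q_h\subseteq Q$ is a finite dimensional subspace and $Q_{ad}^h\subset Q_{ad}$ is a nonempty closed convex subset of $Q_h$. $a_h:X_h\times X_h\to\mathbb R$, $b_h:X_h\times M_h\to\mathbb R$ are bilinear with $|a_h(\mathbf v_h,\mathbf z_h)|\le\bar C_1\|\mathbf v_h\|_h\|\mathbf z_h\|_h$, $|b_h(\mathbf z_h,p_h)|\le\bar C_2\|\mathbf z_h\|_h\|p_h\|_M$; with $Z_h=\{\mathbf v_h\in X_h:b_h(\mathbf v_h,w_h)=0\ \forall w_h\in M_h\}$, $\bar\alpha\|\mathbf v_h\|_h^2\le a_h(\mathbf v_h,\mathbf v_h)$ on $Z_h$, $\bar\alpha>0$; and $\inf_{p_h\in M_h}\sup_{\mathbf z_h\in X_h}b_h(\mathbf z_h,p_h)/(\|\mathbf z_h\|_h\|p_h\|_M)\ge\bar C>0$. $E_h:X_h+X\to Q$ is linear with $E_h\mathbf v=E\mathbf v$ for $\mathbf v\in X$. Discrete optimality system for $((\mathbf u_h,p_h),(\boldsymbol\phi_h,r_h),\mathbf y_h)\in V_h\times V_h\times Q_{ad}^h$: for all $\mathbf z_h\in X_h$, $w_h\in M_h$, $\mathbf x_h\in Q_{ad}^h$,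 $a_h(\mathbf u_h,\mathbf z_h)+b_h(\mathbf z_h,p_h)=\langle\mathbf y_h,E_h\mathbf z_h\rangle_Q+\langle\mathbf f,\mathbf z_h\rangle_W$, $b_h(\mathbf u_h,w_h)=0$, $a_h(\mathbf z_h,\boldsymbol\phi_h)-b_h(\mathbf z_h,r_h)=\langle\mathbf u_h-\mathbf u_d,\mathbf z_h\rangle_W$, $b_h(\boldsymbol\phi_h,w_h)=0$, $\langle E_h\boldsymbol\phi_h+\lambda\mathbf y_h,\mathbf x_h-\mathbf y_h\rangle_Q\ge0$. Standing assumptions. (I) $\|\mathbf v\|_W\le C_W\|\mathbf v\|_h$ for all $\mathbf v\in X+X_h$. (II) $\|E_h(\mathbf v-\mathbf v_h)\|_Q\le\|\mathbf v-\mathbf v_h\|_h$ for all $\mathbf v\in X,\mathbf v_h\in X_h$. (III) $\Pi_h:Q\to Q_h$ is the $Q$-orthogonal projection, and $\Pi_h\mathbf x\in Q_{ad}^h$ whenever $\mathbf x\in Q_{ad}$. Reconstructions. $(R\mathbf u,R_0p),(\bar R\boldsymbol\phi,\bar R_0r)\in X\times M$ are the unique solutions of: for all $\mathbf z\in X$, $w\in M$, $a(R\mathbf u,\mathbf z)+b(\mathbf z,R_0p)=\langle\mathbf y_h,E\mathbf z\rangle_Q+\langle\mathbf f,\mathbf z\rangle_W$, $b(R\mathbf u,w)=0$, $a(\mathbf z,\bar R\boldsymbol\phi)-b(\mathbf z,\bar R_0r)=\langle\mathbf u_h-\mathbf u_d,\mathbf z\rangle_W$, $b(\bar R\boldsymbol\phi,w)=0$.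 ''Independent of the mesh-size'' means: depending only on $\lambda$ and on the constants $C_1,C_2,\alpha,\beta,\bar C_1,\bar C_2,\bar\alpha,\bar C,C_W$. *)

(* Defs.v *)
From HB Require Import structures.
From mathcomp Require Import all_boot all_order all_algebra sesquilinear.
From mathcomp Require Import all_classical all_reals all_analysis.

Set Implicit Arguments.
Unset Strict Implicit.
Unset Printing Implicit Defensive.

Import Order.TTheory GRing.Theory Num.Theory.
Import numFieldNormedType.Exports.

Local Open Scope classical_set_scope.
Local Open Scope ring_scope.

HB.mixin Record isHilbert (R : realType) V of CompleteNormedModule R V := {
  inner : {dot V for (@idfun R)} ;
  inner_normE : forall v : V, inner v v = `|v| ^+ 2
}.

#[short(type="hilbertType")]
HB.structure Definition Hilbert (R : realType) :=
  {V of CompleteNormedModule R V & isHilbert R V}.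

Arguments inner {R s}.

(* Subspaces of a space V are sets in V. A map on a subspace S is a total map
   on V of which only the values on S matter. *)

Definition fin_dim_subspace (R : realType) (V : lmodType R) (S : set V) :=
  exists (n : nat) (e : 'I_n -> V),
    S = [set v | exists c : 'I_n -> R, v = \sum_(i < n) c i *: e i].

(* The subspace X + X_h of W, where iX is the inclusion of X in W. *)
Definition sum_space (R : realType) (X W : lmodType R) (iX : X -> W)
    (Xh : set W) : set W :=
  [set x + y | x in range iX & y in Xh].

Definition linear_on (R : realType) (U V : lmodType R) (S : set U)
    (f : U -> V) :=
  forall (c : R) (u v : U), S u -> S v -> f (c *: u + v) = c *: f u + f v.

Definition bilinear_on (R : realType) (U V : lmodType R) (S : set U)
    (T : set V) (f : U -> V -> R) :=
  (forall (c : R) (u u' : U) (v : V), S u -> S u' -> T v ->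
    f (c *: u + u') v = c * f u v + f u' v) /\
  (forall (c : R) (u : U) (v v' : V), S u -> T v -> T v' ->
    f u (c *: v + v') = c * f u v + f u v').

Definition norm_on (R : realType) (V : lmodType R) (S : set V) (n : V -> R) :=
  [/\ forall v, S v -> 0 <= n v,
      forall v, S v -> n v = 0 -> v = 0,
      forall (c : R) (v : V), S v -> n (c *: v) = `|c| * n v &
      forall u v, S u -> S v -> n (u + v) <= n u + n v].

(* The kernel in S of the form b: Z for b, and Z_h for b_h. *)
Definition form_kernel (R : realType) (U P : Type) (S : set U) (T : set P)
    (b : U -> P -> R) : set U :=
  [set v | S v /\ forall w, T w -> b v w = 0].

(* inf_{p in T, p <> 0} sup_{z in S, z <> 0} b(z, p) / (nU z * nP p). *)
Definition inf_sup (R : realType) (U P : lmodType R) (S : set U) (T : set P)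
    (nU : U -> R) (nP : P -> R) (b : U -> P -> R) : \bar R :=
  ereal_inf [set ereal_sup [set (b z p / (nU z * nP p))%:E | z in S `\ 0]
            | p in T `\ 0].

(* The inclusion W -> X' sends w to the functional z |-> <w, z>_W. *)
Definition to_dual (R : realType) (X : lmodType R) (W : hilbertType R)
    (iX : X -> W) (w : W) : X -> R := fun z => inner w (iX z).

(* X c W c X' with continuous inclusions; continuity of W -> X' is boundedness
   for the dual norm of X'. *)
Definition continuous_inclusions (R : realType) (X W : hilbertType R)
    (iX : {linear X -> W}) :=
  [/\ injective iX, continuous iX, injective (to_dual iX) &
      exists c : R, forall (w : W) (z : X),
        `|to_dual iX w z| <= c * `|w| * `|z|].

Definition orthogonal_projection (R : realType) (Q : hilbertType R)
    (S : set Q) (Pi : Q -> Q) :=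
  forall q, S (Pi q) /\ forall x, S x -> inner (q - Pi q) x = 0.

Record continuous_optimality (R : realType) (X M W Q : hilbertType R)
    (iX : X -> W) (a : X -> X -> R) (b : X -> M -> R) (E : X -> Q)
    (Qad : set Q) (f ud : W) (lambda : R)
    (u : X) (p : M) (phi : X) (r : M) (y : Q) : Prop := {
  co_control_mem : Qad y ;
  co_state : forall z : X,
    a u z + b z p = inner y (E z) + inner f (iX z) ;
  co_state_div : forall w : M, b u w = 0 ;
  co_adjoint : forall z : X,
    a z phi - b z r = inner (iX u - ud) (iX z) ;
  co_adjoint_div : forall w : M, b phi w = 0 ;
  co_control : forall x : Q, Qad x ->
    0 <= inner (E phi + lambda *: y) (x - y)
}.

Record discrete_optimality (R : realType) (M W Q : hilbertType R)
    (Xh : set W) (Mh : set M) (ah : W -> W -> R) (bh : W -> M -> R)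
    (Eh : W -> Q) (Qadh : set Q) (f ud : W) (lambda : R)
    (uh : W) (ph : M) (phih : W) (rh : M) (yh : Q) : Prop := {
  do_state_mem : Xh uh /\ Mh ph ;
  do_adjoint_mem : Xh phih /\ Mh rh ;
  do_control_mem : Qadh yh ;
  do_state : forall z : W, Xh z ->
    ah uh z + bh z ph = inner yh (Eh z) + inner f z ;
  do_state_div : forall w : M, Mh w -> bh uh w = 0 ;
  do_adjoint : forall z : W, Xh z ->
    ah z phih - bh z rh = inner (uh - ud) z ;
  do_adjoint_div : forall w : M, Mh w -> bh phih w = 0 ;
  do_control : forall x : Q, Qadh x ->
    0 <= inner (Eh phih + lambda *: yh) (x - yh)
}.

(* (Ru, R0p) and (Rphi, R0r) solve the continuous state and adjoint equations
   with data y_h and u_h. *)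
Record reconstructions (R : realType) (X M W Q : hilbertType R)
    (iX : X -> W) (a : X -> X -> R) (b : X -> M -> R) (E : X -> Q)
    (f ud uh : W) (yh : Q)
    (Ru : X) (R0p : M) (Rphi : X) (R0r : M) : Prop := {
  rec_state : forall z : X,
    a Ru z + b z R0p = inner yh (E z) + inner f (iX z) ;
  rec_state_div : forall w : M, b Ru w = 0 ;
  rec_adjoint : forall z : X,
    a z Rphi - b z R0r = inner (uh - ud) (iX z) ;
  rec_adjoint_div : forall w : M, b Rphi w = 0
}.

(* Main.v *)
(* The errors du = u - Ru and dphi = phi - Rphi lie in the kernel of b and solve
   the state and adjoint equations with data y - y_h and u - u_h. Testing each
   equation with the other error gives
     <y - y_h, E dphi>_Q = <u - u_h, du>_W >= - |Ru - u_h|_W^2 / 4,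
   so in the sum of the two variational inequalities the term in E dphi has a
   favourable sign up to |Ru - u_h|_W^2, which bounds |y - y_h|_Q. The rest is
   ellipticity of a on the kernel and the triangle inequality. *)
Require Import Defs.
From HB Require Import structures.
From mathcomp Require Import all_boot all_order all_algebra sesquilinear.
From mathcomp Require Import all_classical all_reals all_analysis.
From mathcomp Require Import ring lra.

Import Order.TTheory GRing.Theory Num.Theory.
Import numFieldNormedType.Exports.

Local Open Scope classical_set_scope.
Local Open Scope ring_scope.

(** * Inner products on real Hilbert spaces *)

Section InnerProduct.
Context {R : realType} {V : hilbertType R}.
Implicit Types (c : R) (x y z : V).

Lemma innerC x y : inner x y = inner y x.
Proof. by rewrite (hermC (@inner R V)) expr0 mul1r. Qed.

Lemma inner0l y : inner (0 : V) y = 0.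
Proof. exact: linear0l. Qed.

Lemma innerDl x y z : inner (x + y) z = inner x z + inner y z.
Proof. exact: linearDl. Qed.

Lemma innerNl x z : inner (- x) z = - inner x z.
Proof. exact: linearNl. Qed.

Lemma innerBl x y z : inner (x - y) z = inner x z - inner y z.
Proof. exact: linearBl. Qed.

Lemma innerZl c x z : inner (c *: x) z = c * inner x z.
Proof. exact: linearZl_LR. Qed.

Lemma inner0r x : inner x (0 : V) = 0.
Proof. exact: linear0r. Qed.

Lemma innerNr x z : inner x (- z) = - inner x z.
Proof. exact: linearNr. Qed.

Lemma innerBr x y z : inner x (y - z) = inner x y - inner x z.
Proof. exact: linearBr. Qed.

Lemma innerZr c x z : inner x (c *: z) = c * inner x z.
Proof. exact: linearZr_LR. Qed.

(** Cauchy-Schwarz: expand the square norm of [|y| *: x - |x| *: y] and cancel the factor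
    [|x| * |y|], positive once both vectors are nonzero. *)
Lemma inner_le_norm x y :
  inner x y <= `|x| * `|y|.
Proof.
have [->|x_neq0] := eqVneq x 0.
  by rewrite inner0l mulr_ge0.
have [->|y_neq0] := eqVneq y 0.
  by rewrite inner0r mulr_ge0.
have pos : 0 < `|x| * `|y| by rewrite mulr_gt0 ?normr_gt0.
have : 0 <= inner (`|y| *: x - `|x| *: y) (`|y| *: x - `|x| *: y).
  by rewrite inner_normE exprn_ge0.
rewrite !innerBl !innerBr.
rewrite !innerZl !innerZr /=.
rewrite !inner_normE (innerC y x) => h.
have : 0 <= (`|x| * `|y|) * (`|x| * `|y| - inner x y) by lra.
by rewrite pmulr_rge0 // subr_ge0.
Qed.

(** Cauchy-Schwarz reduces this to the square of [|x| - |y| / 2]. It is meant for [x] an unknown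
    error and [y] a computable residual: [x] drops out of the bound. *)
Lemma inner_ge_quarter x y :
  - (`|y| ^+ 2 / 4) <= inner (x + y) x.
Proof.
have := inner_le_norm (- y) x.
rewrite normrN innerNl => h.
rewrite innerDl inner_normE.
have := sqr_ge0 (`|x| - `|y| / 2); lra.
Qed.

End InnerProduct.

(** * Finite dimensional subspaces and norms on them *)

Lemma fin_dim_subspaceP {R : realType} {V : lmodType R} {S : set V} :
  fin_dim_subspace S ->
  S 0 /\ forall (c : R) (u v : V), S u -> S v -> S (c *: u + v).
Proof.
move=> [n [e ->]]; split=> [|c u v [cu ->] [cv ->]].
  exists (fun=> 0); rewrite big1 // => i _; exact: scale0r.
exists (fun i => c * cu i + cv i); rewrite scaler_sumr -big_split /=.
by apply: eq_bigr => i _; rewrite scalerDl scalerA.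
Qed.

Lemma fin_dim_subspaceB {R : realType} {V : lmodType R} {S : set V} {u v : V} :
  fin_dim_subspace S -> S u -> S v -> S (u - v).
Proof.
move=> /fin_dim_subspaceP[_ SP] Su Sv.
by rewrite addrC -scaleN1r; exact: SP.
Qed.

Lemma norm_onN {R : realType} {V : lmodType R} {S : set V} {n : V -> R}
    {v : V} :
  norm_on S n -> S v -> n (- v) = n v.
Proof. by case=> _ _ nZ _ Sv; rewrite -scaleN1r nZ // normrN1 mul1r. Qed.

(** * Linear bounds from quadratic inequalities *)

Lemma le_of_quadratic {R : realFieldType} {c k x : R} :
  0 < c -> 0 <= k -> c * x ^+ 2 <= k * x -> x <= k / c.
Proof.
move=> c_gt0 k_ge0 h; rewrite ler_pdivlMr // leNgt; apply/negP => kx.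
have x_gt0 : 0 < x by rewrite -(pmulr_lgt0 _ c_gt0); exact: le_lt_trans kx.
have : 0 < x * (x * c - k) by rewrite mulr_gt0 // subr_gt0.
lra.
Qed.

(** By contradiction: the summand 1 makes the factor at least 1, so a larger [d] exceeds [S]. Then
    [S ^+ 2 <= S * d], the right side is at most [(1 + c ^+ 2) * S * d], and [l * d ^+ 2] is larger
    than that. *)
Lemma le_of_quadratic_sqr {R : realFieldType} {l c S d : R} :
  0 < l -> 0 <= S ->
  l * d ^+ 2 <= c ^+ 2 * S ^+ 2 + S * d -> d <= ((1 + c ^+ 2) / l + 1) * S.
Proof.
move=> l_gt0 S_ge0 h; set K := (X in X * S).
have Kl : l * K = 1 + c ^+ 2 + l by rewrite /K; field; rewrite gt_eqF.
have c2_ge0 := sqr_ge0 c.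
have K_ge1 : 1 <= K.
  by rewrite /K lerDr divr_ge0 // ?(ltW l_gt0) // addr_ge0.
rewrite leNgt; apply/negP => Kd.
have Sd : S < d by apply: le_lt_trans Kd; rewrite ler_peMl.
have d_gt0 : 0 < d by exact: le_lt_trans Sd.
have : l * K * S < l * d by rewrite -mulrA ltr_pM2l.
rewrite Kl => h1.
have h2 : 0 < d * (l * d - (1 + c ^+ 2 + l) * S) by rewrite mulr_gt0 ?subr_gt0.
have h3 : 0 <= c ^+ 2 * S * (d - S).
  by apply: mulr_ge0; [exact: mulr_ge0|rewrite subr_ge0 ltW].
have h4 : 0 <= l * S * d by rewrite !mulr_ge0 ?(ltW l_gt0) // ltW.
lra.
Qed.

(** * Projection and the variational inequalities *)

Lemma orthogonal_projection_inner {R : realType} {Q : hilbertType R}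
    {S : set Q} {P : Q -> Q} (q : Q) {x : Q} :
  orthogonal_projection S P -> S x -> inner (P q) x = inner q x.
Proof.
move=> /(_ q)[_ +] Sx => /(_ x Sx).
by rewrite innerBl => /eqP; rewrite subr_eq0 => /eqP.
Qed.

(* Sum of the two variational inequalities: testing the discrete one with the
   projection of [y] replaces [gh] by its projection. *)
Lemma control_error {R : realType} {Q : hilbertType R}
    {Qad Qh Qadh : set Q} {P : Q -> Q} {lambda : R} {g gh y yh : Q} :
  fin_dim_subspace Qh -> Qadh `<=` Qad -> Qadh `<=` Qh ->
  orthogonal_projection Qh P -> (forall x, Qad x -> Qadh (P x)) ->
  Qad y -> Qadh yh ->
  (forall x, Qad x -> 0 <= inner (g + lambda *: y) (x - y)) ->
  (forall x, Qadh x -> 0 <= inner (gh + lambda *: yh) (x - yh)) ->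
  lambda * `|y - yh| ^+ 2 <= inner (g - P gh) (yh - y).
Proof.
move=> Qh_sub sub_ad sub_h projP P_ad Qy Qyh vi vih.
have Qhyh := sub_h _ Qyh.
have h1 := vi _ (sub_ad _ Qyh).
have := vih _ (P_ad _ Qy).
have QP : Qh (P y - yh) by apply: fin_dim_subspaceB => //; case: (projP y).
rewrite innerDl -(orthogonal_projection_inner _ projP QP).
rewrite -innerDl => h2.
have Qt : Qh (P gh + lambda *: yh).
  have [_ SP] := fin_dim_subspaceP Qh_sub.
  by rewrite addrC; apply: SP => //; case: (projP gh).
(* Now that the left factor lies in [Qh], the test element [P y] may in turn be replaced by [y]. *)
have h3 : 0 <= inner (P gh + lambda *: yh) (y - yh).
  move: h2; rewrite !innerBr.
  rewrite [X in _ <= X - _ -> _]innerC.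
  by rewrite (orthogonal_projection_inner _ projP Qt) [in X in X -> _]innerC.
have : 0 <= inner (P gh + lambda *: yh - (g + lambda *: y)) (y - yh).
  rewrite innerBl -(opprB yh) (innerNr _ (yh - y)).
  rewrite (innerNr _ (yh - y)) opprK addr_ge0 //.
  by rewrite -innerNr opprB.
have -> : P gh + lambda *: yh - (g + lambda *: y) =
    - (g - P gh) - lambda *: (y - yh).
  by rewrite scalerBr !opprB opprD addrACA.
rewrite [in X in X -> _]innerBl innerZl inner_normE subr_ge0.
by rewrite innerNl -innerNr opprB.
Qed.

Theorem theorem2p8 (R : realType)
    (lambda C1 C2 alpha beta C1h C2h alphah Ch CW : R)
    (lambda_gt0 : 0 < lambda) (alpha_gt0 : 0 < alpha) (beta_gt0 : 0 < beta)
    (alphah_gt0 : 0 < alphah) (Ch_gt0 : 0 < Ch) :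
  exists2 C : R, 0 < C &
    forall
      (* continuous setting *)
      (X M W Q : hilbertType R) (iX : {linear X -> W})
      (XWX' : continuous_inclusions iX)
      (E : {linear X -> Q}) (E_continuous : continuous E)
      (Qad : set Q) (Qad_nonempty : Qad !=set0) (Qad_closed : closed Qad)
      (Qad_convex : convex_set Qad)
      (f ud : W)
      (a : {bilinear X -> X -> R | *%R & *%R})
      (b : {bilinear X -> M -> R | *%R & *%R})
      (a_bounded : forall v z, `|a v z| <= C1 * `|v| * `|z|)
      (b_bounded : forall z p, `|b z p| <= C2 * `|z| * `|p|)
      (a_elliptic : forall v, form_kernel setT setT b v ->
         alpha * `|v| ^+ 2 <= a v v)
      (b_inf_sup : (beta%:E <=
         inf_sup setT setT (@Num.norm R X) (@Num.norm R M) b)%E)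
      (* discrete setting *)
      (Xh : set W) (Xh_subspace : fin_dim_subspace Xh)
      (nh : W -> R) (nh_norm : norm_on (sum_space iX Xh) nh)
      (nh_X : forall v : X, nh (iX v) = `|v|)
      (Mh : set M) (Mh_subspace : fin_dim_subspace Mh)
      (Qh : set Q) (Qh_subspace : fin_dim_subspace Qh)
      (Qadh : set Q) (Qadh_Qad : Qadh `<=` Qad) (Qadh_Qh : Qadh `<=` Qh)
      (Qadh_nonempty : Qadh !=set0) (Qadh_closed : closed Qadh)
      (Qadh_convex : convex_set Qadh)
      (ah : W -> W -> R) (ah_bilinear : bilinear_on Xh Xh ah)
      (bh : W -> M -> R) (bh_bilinear : bilinear_on Xh Mh bh)
      (ah_bounded : forall v z, Xh v -> Xh z ->
         `|ah v z| <= C1h * nh v * nh z)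
      (bh_bounded : forall z p, Xh z -> Mh p ->
         `|bh z p| <= C2h * nh z * `|p|)
      (ah_elliptic : forall v, form_kernel Xh Mh bh v ->
         alphah * nh v ^+ 2 <= ah v v)
      (bh_inf_sup : (Ch%:E <= inf_sup Xh Mh nh (@Num.norm R M) bh)%E)
      (Eh : W -> Q) (Eh_linear : linear_on (sum_space iX Xh) Eh)
      (Eh_X : forall v : X, Eh (iX v) = E v)
      (* standing assumptions *)
      (asm_I : forall v, sum_space iX Xh v -> `|v| <= CW * nh v)
      (asm_II : forall (v : X) (vh : W), Xh vh ->
         `|Eh (iX v - vh)| <= nh (iX v - vh))
      (Pih : Q -> Q) (Pih_projection : orthogonal_projection Qh Pih)
      (asm_III : forall x, Qad x -> Qadh (Pih x))
      (* solutions and reconstructions *)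
      (u : X) (p : M) (phi : X) (r : M) (y : Q)
      (continuous_solution :
         continuous_optimality iX a b E Qad f ud lambda u p phi r y)
      (uh : W) (ph : M) (phih : W) (rh : M) (yh : Q)
      (discrete_solution :
         discrete_optimality Xh Mh ah bh Eh Qadh f ud lambda uh ph phih rh yh)
      (Ru : X) (R0p : M) (Rphi : X) (R0r : M)
      (reconstruction :
         reconstructions iX a b E f ud uh yh Ru R0p Rphi R0r),
    nh (iX u - uh) <=
      C * (nh (iX Ru - uh) + `|Eh phih - Pih (Eh phih)| + nh (phih - iX Rphi))
    /\
    nh (iX phi - phih) <=
      C * (nh (phih - iX Rphi) + nh (iX Ru - uh) + `|Eh phih - Pih (Eh phih)|).
Proof.
(* [K] is the factor of [le_of_quadratic_sqr] for the control error. In [D] and [D'] the quotient by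
   [alpha] comes from ellipticity and the 1 from the triangle inequality through the
   reconstruction. *)
set K := (1 + CW ^+ 2) / lambda + 1.
have K_ge1 : 1 <= K.
  by rewrite lerDr divr_ge0 ?(ltW lambda_gt0) // addr_ge0 // sqr_ge0.
set D := K / alpha + 1; set D' := CW ^+ 2 * D / alpha + 1.
have D_ge1 : 1 <= D.
  by rewrite lerDr divr_ge0 ?(ltW alpha_gt0) // (le_trans ler01).
have D_ge0 := le_trans ler01 D_ge1.
have D'_ge1 : 1 <= D'.
  by rewrite lerDr divr_ge0 ?(ltW alpha_gt0) // mulr_ge0 // sqr_ge0.
exists (D + D'); first by lra.
move=> X M W Q iX _ E _ Qad _ _ _ f ud a b _ _ a_ell _ Xh Xh_sub nh nh_norm
  nh_X Mh _ Qh Qh_sub Qadh sub_ad sub_h _ _ _ ah _ bh _ _ _ _ _ Eh Eh_lin Eh_X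
  asm_I asm_II P projP P_ad u p phi r y [Qy st st0 adj adj0 vi] uh ph phih rh yh
  [[Xuh _] [Xphih _] Qyh _ _ _ _ vih] Ru R0p Rphi R0r [rst rst0 radj radj0].
have [Xh0 _] := fin_dim_subspaceP Xh_sub.
have sum_X v : sum_space iX Xh (iX v).
  by exists (iX v); [exists v|exists 0; rewrite ?addr0].
have sumB v wh : Xh wh -> sum_space iX Xh (iX v - wh).
  move=> Xwh; exists (iX v); first by exists v.
  by exists (- wh) => //; rewrite -sub0r; exact: fin_dim_subspaceB.
(* The absolute value makes the factor nonnegative, so that the bound can be squared; it disappears
   in [CW ^+ 2]. *)
have normW v : sum_space iX Xh v -> `|v| <= `|CW| * nh v.
  move=> Sv; apply: (le_trans (asm_I _ Sv)); rewrite ler_wpM2r ?ler_norm //.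
  by case: nh_norm => + _ _ _; exact.
(* The case [vh = 0] of [asm_II]. *)
have normE v : `|E v| <= `|v|.
  by have := asm_II v 0 Xh0; rewrite subr0 Eh_X nh_X.
set du := u - Ru; set dphi := phi - Rphi; set d := `|y - yh|.
set A := nh (iX Ru - uh); set B := nh (phih - iX Rphi).
set H := `|Eh phih - P (Eh phih)|.
have A_ge0 : 0 <= A by case: nh_norm => + _ _ _; apply; exact: sumB.
have BE : B = nh (iX Rphi - phih).
  by rewrite /B -(norm_onN nh_norm (sumB _ _ Xphih)) opprB.
have B_ge0 : 0 <= B.
  by rewrite BE; case: nh_norm => + _ _ _; apply; exact: sumB.
have H_ge0 : 0 <= H by exact: normr_ge0.
have d_ge0 : 0 <= d by exact: normr_ge0.
have du0 w : b du w = 0 by rewrite linearBl st0 rst0 subr0.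
have dphi0 w : b dphi w = 0 by rewrite linearBl adj0 radj0 subr0.
(* Both premises hold for [z] in the kernel of [b], in particular for [du] and [dphi]. *)
have state z : b z p = 0 -> b z R0p = 0 -> a du z = inner (y - yh) (E z).
  move=> zp zR; have := st z; have := rst z.
  by rewrite linearBl innerBl zp zR !addr0 => -> ->; lra.
have adjoint z : b z r = 0 -> b z R0r = 0 ->
    a z dphi = inner (iX u - uh) (iX z).
  move=> zr zR; have := adj z; have := radj z.
  by rewrite linearBr !innerBl zr zR !subr0 => -> ->; lra.
have ell v : (forall w, b v w = 0) -> alpha * `|v| ^+ 2 <= a v v.
  by move=> v0; apply: a_ell; split.
have key : - (CW ^+ 2 * A ^+ 2) <= inner (y - yh) (E dphi).
  rewrite -state // adjoint //.
  (* The form to which [inner_ge_quarter] applies, with residual [iX Ru - uh]; its factor 1/4 is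
     then given away. *)
  have -> : iX u - uh = iX du + (iX Ru - uh) by rewrite linearB addrA subrK.
  apply: le_trans (inner_ge_quarter _ _); rewrite lerN2.
  have := normW _ (sumB Ru _ Xuh); rewrite -/A => h.
  have : `|iX Ru - uh| ^+ 2 <= (`|CW| * A) ^+ 2.
    by rewrite lerXn2r ?nnegrE ?mulr_ge0.
  rewrite exprMn real_normK ?num_real // => h2.
  have := sqr_ge0 `|iX Ru - uh|; lra.
have EhB : Eh (iX Rphi - phih) = E Rphi - Eh phih.
  have Sphih : sum_space iX Xh phih.
    by exists 0; [exists 0; rewrite ?linear0|exists phih; rewrite ?add0r].
  have := Eh_lin (-1) _ _ Sphih (sum_X Rphi).
  by rewrite !scaleN1r Eh_X ![- _ + _]addrC.
have control : d <= K * (A + B + H).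
  apply: le_of_quadratic_sqr => //; first by rewrite !addr_ge0.
  have := control_error Qh_sub sub_ad sub_h projP P_ad Qy Qyh vi vih.
  (* The first term is handled by [key]; the other two have norms at most [B], by [asm_II], and
     [H]. *)
  have -> : E phi - P (Eh phih) =
      E dphi + (E Rphi - Eh phih + (Eh phih - P (Eh phih))).
    by rewrite linearB -!addrA !addKr.
  rewrite innerDl innerDl -(opprB y) !innerNr.
  rewrite [inner (E dphi) _]innerC -!innerNl -/d => h.
  have h1 := inner_le_norm (- (E Rphi - Eh phih)) (y - yh).
  have h2 := inner_le_norm (- (Eh phih - P (Eh phih))) (y - yh).
  have := asm_II Rphi _ Xphih; rewrite EhB -BE => h3.
  rewrite !normrN -/d -/H in h1 h2.
  have h4 : `|E Rphi - Eh phih| * d <= B * d by rewrite ler_wpM2r.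
  have h5 : CW ^+ 2 * A ^+ 2 <= CW ^+ 2 * (A + B + H) ^+ 2.
    rewrite ler_wpM2l ?sqr_ge0 // lerXn2r ?nnegrE ?addr_ge0 //; lra.
  have h6 : 0 <= A * d by rewrite mulr_ge0.
  rewrite innerNl in h; lra.
have du_le : `|du| <= d / alpha.
  apply: le_of_quadratic => //; apply: (le_trans (ell _ du0)).
  rewrite state //; apply: (le_trans (inner_le_norm _ _)).
  by rewrite ler_wpM2l.
have triangle v v' wh : Xh wh ->
    nh (iX v - wh) <= `|v - v'| + nh (iX v' - wh).
  move=> Xwh; case: nh_norm => _ _ _ nhD.
  have -> : iX v - wh = iX (v - v') + (iX v' - wh).
    by rewrite linearB addrA subrK.
  by rewrite -(nh_X (v - v')); apply: nhD => //; exact: sumB.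
set S := A + B + H in control.
have S_ge0 : 0 <= S by rewrite !addr_ge0.
have [AS BS] : A <= S /\ B <= S by rewrite /S; split; lra.
have u_le : nh (iX u - uh) <= D * S.
  apply: (le_trans (triangle u Ru _ Xuh)); rewrite -/du -/A.
  have : d / alpha <= K * S / alpha by rewrite ler_pM2r ?invr_gt0.
  rewrite /D; lra.
(* The adjoint data is [u - u_h], so [u_le] is needed first. Both factors of the W inner product are
   bounded by [normW], whence [CW ^+ 2]. *)
have dphi_le : `|dphi| <= CW ^+ 2 * D * S / alpha.
  have DS_ge0 : 0 <= CW ^+ 2 * D * S.
    by apply: mulr_ge0 => //; apply: mulr_ge0 => //; exact: sqr_ge0.
  apply: le_of_quadratic => //; apply: (le_trans (ell _ dphi0)).
  rewrite adjoint //; apply: (le_trans (inner_le_norm _ _)).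
  have h1 := normW _ (sumB u _ Xuh).
  have h2 := normW _ (sum_X dphi); rewrite nh_X in h2.
  apply: (le_trans (ler_pM _ _ h1 h2)) => //.
  rewrite mulrACA -expr2 real_normK ?num_real // -!(mulrA (CW ^+ 2)).
  by apply: ler_wpM2l; [exact: sqr_ge0|rewrite ler_wpM2r].
have phi_le : nh (iX phi - phih) <= D' * S.
  apply: (le_trans (triangle phi Rphi _ Xphih)); rewrite -/dphi -BE.
  rewrite /D'; lra.
have DS : 0 <= D * S by rewrite mulr_ge0.
have D'S : 0 <= D' * S by rewrite mulr_ge0 // (le_trans ler01).
have -> : A + H + B = S by rewrite addrAC.
have -> : B + A + H = S by rewrite [B + A]addrC.
rewrite mulrDl; split; lra.
Qed.
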